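(* Let $k$ be a positive integer and consider the $k$-th order system of two rational difference equations $$x_n=\frac{\alpha+\sum^{k}_{i=1}\beta_{i}x_{n-i} + \sum^{k}_{i=1}\gamma_{i}y_{n-i}}{A+\sum^{k}_{j=1}B_{j}x_{n-j} + \sum^{k}_{j=1}C_{j}y_{n-j}},\qquad y_n=\frac{p+\sum^{k}_{i=1}\delta_{i}x_{n-i} + \sum^{k}_{i=1}\epsilon_{i}y_{n-i}}{q+\sum^{k}_{j=1}D_{j}x_{n-j} + \sum^{k}_{j=1}E_{j}y_{n-j}},\qquad n\in\mathbb{N},$$ with non-negative real parameters and non-negative initial conditions. Assume that there exist $M_1>0$ and $M_2\ge 0$ such that every solution satisfies $y_n\le M_1x_n+M_2$ for all $n\in\mathbb{N}$. Assume further that $A=0$, $q>0$, and that at least one of the following holds: (i) $I_B\subseteq I_\beta$, $I_C\subseteq I_\gamma$, and $I_B\neq\emptyset$; (ii) $p>0$, $I_D\subseteq I_\delta$, $I_E\subseteq I_\epsilon$, and $I_C\neq\emptyset$. Assume moreover that $I_\delta\subseteq I_D$; that there exists a positive integer $\eta_1$ such that for every sequence $\{c_m\}_{m=1}^\infty$ with $c_m\in I_\epsilon$ for all $m\ge 1$ there exist positive integers $N_1,N_2\le\eta_1$ such that $\sum_{m=N_1}^{N_2}c_m\in I_D\cup I_E$; and that there exists a positive integer $\eta_2$ such that for every sequence $\{d_m\}_{m=1}^\infty$ with $d_m\in I_\beta$ for all $m\ge 1$ there exist positive integers $N_3,N_4\le\eta_2$ such that $\sum_{m=N_3}^{N_4}d_m\in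 I_B$. Then there exist $M>0$ and $N\in\mathbb{N}$ such that every solution (from any non-negative initial conditions) satisfies $x_n\le M$ and $y_n\le M$ for all $n>N$.
   Context: $\mathbb{N}=\{1,2,\dots\}$. Initial conditions are $x_{1-k},\dots,x_0,y_{1-k},\dots,y_0\ge 0$; a solution is a pair of sequences generated by the system from non-negative initial conditions for which all denominators are positive for every $n\in\mathbb{N}$. For each family of coefficients, the index set is the set of indices in $\{1,\dots,k\}$ with positive coefficient: $I_\beta=\{i:\beta_i>0\}$, $I_\gamma=\{i:\gamma_i>0\}$, $I_\delta=\{i:\delta_i>0\}$, $I_\epsilon=\{i:\epsilon_i>0\}$, $I_B=\{j:B_j>0\}$, $I_C=\{j:C_j>0\}$, $I_D=\{j:D_j>0\}$, $I_E=\{j:E_j>0\}$. A sum whose lower limit exceeds its upper limit is empty and equals $0$. *)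

(* Defs.v *)
From mathcomp Require Import all_boot all_order all_algebra.
From mathcomp Require Import reals.

Set Implicit Arguments.
Unset Strict Implicit.
Unset Printing Implicit Defensive.

Import Order.TTheory GRing.Theory Num.Theory.
Local Open Scope ring_scope.

(* A coefficient family indexed by {1, ..., k} is a function u : nat -> R whose
   values outside that range are never used.  A sequence indexed by the
   integers m >= 1 - k is a function int -> R whose values at smaller indices
   are never used. *)

Definition nonneg_coefs (R : realType) (k : nat) (u : nat -> R) : Prop :=
  forall i, (1 <= i <= k)%N -> 0 <= u i.

Definition index_set (R : realType) (k : nat) (u : nat -> R) : {pred nat} :=
  [pred i : nat | (1 <= i <= k)%N && (0 < u i)].

Definition affine_lag (R : realType) (k : nat) (a : R) (u v : nat -> R)
    (x y : int -> R) (n : nat) : R :=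
  a + \sum_(1 <= i < k.+1) u i * x (n%:Z - i%:Z)
    + \sum_(1 <= i < k.+1) v i * y (n%:Z - i%:Z).

Definition solution (R : realType) (k : nat)
    (alpha : R) (beta gamma : nat -> R) (A : R) (B C : nat -> R)
    (p : R) (delta epsilon : nat -> R) (q : R) (D E : nat -> R)
    (x y : int -> R) : Prop :=
  (forall m : int, 1 - k%:Z <= m <= 0 -> 0 <= x m /\ 0 <= y m) /\
  (forall n : nat, (1 <= n)%N ->
    [/\ 0 < affine_lag k A B C x y n,
        0 < affine_lag k q D E x y n,
        x n%:Z = affine_lag k alpha beta gamma x y n
                 / affine_lag k A B C x y n
      & y n%:Z = affine_lag k p delta epsilon x y n
                 / affine_lag k q D E x y n]).

(* The range N1 <= m < N2.+1 is empty when N2 < N1, and the sum is then 0. *)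
Definition block_sum_property (I J : {pred nat}) : Prop :=
  exists eta : nat, (1 <= eta)%N /\
    forall c : nat -> nat, (forall m, (1 <= m)%N -> c m \in I) ->
      exists N1 N2 : nat,
        [/\ (1 <= N1 <= eta)%N, (1 <= N2 <= eta)%N
          & (\sum_(N1 <= m < N2.+1) c m)%N \in J].

(* Main.v *)
(* A variable u satisfying u_n <= K + sum_i b_i u_(n-i) / den_n is unrolled
   along its delays.  The factors 1 / den picked up on the way are bounded, and
   when a block of consecutive delays has its sum s in J, the factor
   1 / den_(m+s) at the top of the block absorbs the current value u_m, since
   u_m <= L den_(m+s).  The block sum property makes this happen within eta
   steps, so u is bounded by a constant independent of the solution.

   For y the denominators are at least q > 0; the delta terms are dominated by
   the denominator, and y_(n-s) by M1 x_(n-s) + M2, hence by the denominator,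
   when s is in I_D.  Each of (i), (ii) dominates one of the two denominators by
   its own numerator, which keeps x (resp. y) away from 0 and hence also the
   denominator of x, so the same unrolling bounds x once y is bounded. *)
Require Import Defs.
From mathcomp Require Import all_boot all_order all_algebra.
From mathcomp Require Import reals.
From mathcomp Require Import zify lra.

Set Implicit Arguments.
Unset Strict Implicit.
Unset Printing Implicit Defensive.

Import Order.TTheory GRing.Theory Num.Theory.
Local Open Scope ring_scope.

(** * Products of reciprocal denominators along a history of delays *)

(** [c 1] is the delay unrolled first and [c j] the last, so the product runs upwards from the
    current index [n]: its factors are the inverses of [den] at [n + c j], [n + c j + c (j-1)], and
    so on up to the index where the unrolling began. *)
Fixpoint path_weight (R : fieldType) (den : nat -> R) (n : nat) (c : nat -> nat)
    (j : nat) : R :=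
  if j is j'.+1 then
    path_weight den (n + c j)%N c j' / den (n + c j)%N
  else 1.

Lemma eq_path_weight (R : fieldType) (den : nat -> R) (c c' : nat -> nat) j n :
  (forall m, (1 <= m <= j)%N -> c m = c' m) ->
  path_weight den n c j = path_weight den n c' j.
Proof.
elim: j n => [//|j IH] n eqc /=.
by rewrite (eqc j.+1) ?ltnSn // IH // => m ?; apply: eqc; lia.
Qed.

Lemma path_weight_bounds (R : realFieldType) (den : nat -> R) (G : R) (N0 : nat)
    (c : nat -> nat) j n :
  1 <= G -> (forall n, (N0 < n)%N -> 0 < den n /\ (den n)^-1 <= G) ->
  (N0 < n)%N -> 0 <= path_weight den n c j <= G ^+ j.
Proof.
move=> G1 hden; elim: j n => [|j IH] n hn /=; first by rewrite ler01 expr0 lexx.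
have hn' : (N0 < n + c j.+1)%N by lia.
have [d0 dG] := hden _ hn'; have /andP[w0 wG] := IH _ hn'.
by rewrite divr_ge0 ?(ltW d0) // exprSr ler_pM // invr_ge0 ltW.
Qed.

(** The block reaches down to the current index, so its top is a visited index and [den] there
    cancels one factor. The other [j - 1] factors are at most [G] each, and [1 <= G] allows the
    exponent [j]. *)
Lemma den_path_weight_le (R : realFieldType) (den : nat -> R) (G : R) (N0 : nat)
    (c : nat -> nat) N1 j n :
  1 <= G -> (forall n, (N0 < n)%N -> 0 < den n /\ (den n)^-1 <= G) ->
  (N0 < n)%N -> (1 <= N1 <= j)%N ->
  den (n + \sum_(N1 <= m < j.+1) c m)%N * path_weight den n c j <= G ^+ j.
Proof.
move=> G1 hden; elim: j n => [|j IH] n hn /= hN1; first by lia.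
have hn' : (N0 < n + c j.+1)%N by lia.
have [d0 dG] := hden _ hn'; have /andP[w0 wG] := path_weight_bounds c j G1 hden hn'.
have [N1j|N1j] := leqP N1 j.
  rewrite big_nat_recr /=; last by lia.
  rewrite (addnC _ (c _)) addnA mulrA exprSr.
  have hs : (N0 < n + c j.+1 + \sum_(N1 <= m < j.+1) c m)%N by lia.
  apply: ler_pM => //; first by rewrite mulr_ge0 // ltW // (hden _ hs).1.
    by rewrite invr_ge0 ltW.
  by apply: IH => //; lia.
have -> : N1 = j.+1 by lia.
rewrite big_nat1 mulrC divfK ?gt_eqF //.
by apply: (le_trans wG); rewrite ler_weXn2l.
Qed.

(** * Bounds uniform over all recursions with the same constants *)

Definition lag_recursion (R : realFieldType) (k : nat) (b : nat -> R)
    (J : {pred nat}) (K L G : R) (N0 : nat) (u den : nat -> R) : Prop :=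
  forall n, (N0 < n)%N ->
    [/\ 0 <= u n, 0 < den n, (den n)^-1 <= G,
        u n <= K + \sum_(1 <= i < k.+1) b i * (u (n - i)%N / den n)
      & forall s, s \in J -> u (n - s)%N <= L * den n].

(* A history [c 1, ..., c j] none of whose blocks has its sum in [J] is shorter
   than [eta]; unrolling once more either closes a block, and then the factor
   [1 / den] sitting at the top of the block absorbs [u], or leaves a longer
   history of the same kind. *)
Lemma history_bound (R : realType) (k : nat) (b : nat -> R) (J : {pred nat})
    (K L G : R) (N0 eta d : nat) :
  0 <= K -> 0 <= L -> 1 <= G -> nonneg_coefs k b -> 0%N \notin J ->
  (forall c : nat -> nat, (forall m, (1 <= m)%N -> c m \in index_set k b) ->
    exists N1 N2 : nat, [/\ (1 <= N1 <= eta)%N, (1 <= N2 <= eta)%N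
          & (\sum_(N1 <= m < N2.+1) c m)%N \in J]) ->
  exists M : R, 0 <= M /\ forall u den, lag_recursion k b J K L G N0 u den ->
    forall c j, (j + d = eta)%N ->
    (forall m, (1 <= m)%N -> c m \in index_set k b) ->
    (forall N1 N2, (1 <= N1 <= j)%N -> (1 <= N2 <= j)%N ->
       (\sum_(N1 <= m < N2.+1) c m)%N \notin J) ->
    forall n, (N0 + k * d < n)%N -> u n * path_weight den n c j <= M.
Proof.
move=> K0 L0 G1 b0 J0 block; elim: d => [|d [M [M0 IH]]].
  (* At full length [eta] the block property contradicts the absence of closed blocks, so the claim
     is vacuous. *)
  exists 0; split=> // u den rec c j; rewrite addn0 => -> cI nohit.
  have [N1 [N2 [h1 h2 hJ]]] := block c cI.
  by move: (nohit N1 N2 h1 h2); rewrite hJ.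
have G0 : 0 <= G by lra.
(* One more unrolling leaves either a longer history, bounded by [M], or a closed block, bounded by
   [L * G ^+ eta]. *)
pose M' := M + L * G ^+ eta.
have M'0 : 0 <= M' by rewrite addr_ge0 // mulr_ge0 // exprn_ge0.
have S0 : 0 <= \sum_(1 <= i < k.+1) b i * M'.
  by rewrite big_nat_cond sumr_ge0 // => i /andP[hi _]; rewrite mulr_ge0 // b0.
exists (K * G ^+ eta + \sum_(1 <= i < k.+1) b i * M'); split.
  by rewrite addr_ge0 // mulr_ge0 // exprn_ge0.
move=> u den rec c j jd cI nohit n hn.
have jeta : (j.+1 <= eta)%N by clear -jd; lia.
have hden m : (N0 < m)%N -> 0 < den m /\ (den m)^-1 <= G.
  by move=> /rec[].
have hn0 : (N0 < n)%N by clear -hn; lia.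
have [u0 d0 dG un _] := rec _ hn0.
have /andP[w0 wG] := path_weight_bounds c j G1 hden hn0.
apply: (le_trans (ler_wpM2r w0 un)).
rewrite mulrDl lerD //.
  by apply: ler_wpM2l => //; apply: (le_trans wG); rewrite ler_weXn2l // ltnW.
rewrite mulr_suml big_nat_cond [leRHS]big_nat_cond ler_sum // => i /andP[hi _].
have bi0 : 0 <= b i by rewrite b0.
have [bi|bi] := ltP 0 (b i); last first.
  by have -> : b i = 0 by [lra|]; rewrite !mul0r.
rewrite -mulrA ler_wpM2l //.
(* Each unrolling lowers the index by at most [k]; the margin pays for the [d] that remain and rules
   out truncation in [n - i]. *)
set m := (n - i)%N; have hm : (N0 + k * d < m)%N by rewrite /m; clear -hn hi; lia.
have hm0 : (N0 < m)%N by clear -hm; lia.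
pose c' := fun l => if l == j.+1 then i else c l.
have c'I l : (1 <= l)%N -> c' l \in index_set k b.
  by rewrite /c'; case: eqP => [_ _|_ /cI//]; rewrite !inE bi andbT.
have c'c l : (1 <= l <= j)%N -> c' l = c l.
  by rewrite /c'; case: eqP => // ->; rewrite ltnn andbF.
have -> : u m / den n * path_weight den n c j = u m * path_weight den m c' j.+1.
  rewrite /= /c' eqxx; have -> : (m + i)%N = n by rewrite /m; clear -hn hi; lia.
  rewrite -mulrA; congr (_ * _); rewrite mulrC; congr (_ / _).
  by apply: eq_path_weight => l /c'c.
have um0 : 0 <= u m by have [] := rec _ hm0.
(* Only blocks ending in the new entry need testing; [nohit] excludes the others. *)
have [/existsP[N1 /andP[N1p hit]]|nohit'] :=
    boolP [exists N1 : 'I_j.+2, (1 <= N1)%N && ((\sum_(N1 <= m < j.+2) c' m)%N \in J)].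
  set s := (\sum_(N1 <= m < j.+2) c' m)%N in hit.
  have hms : (N0 < m + s)%N by clear -hm0; lia.
  have [_ _ _ _ /(_ _ hit)] := rec _ hms; rewrite addnK => us.
  have /andP[w'0 _] := path_weight_bounds c' j.+1 G1 hden hm0.
  apply: (le_trans (ler_wpM2r w'0 us)).
  apply: (@le_trans _ _ (L * G ^+ eta)); last by rewrite lerDr.
  rewrite -mulrA ler_wpM2l //.
  apply: (@le_trans _ _ (G ^+ j.+1)); last by rewrite ler_weXn2l.
  apply: (den_path_weight_le c' G1 hden hm0).
  by rewrite N1p /= -ltnS ltn_ord.
apply: (@le_trans _ _ M); last by rewrite lerDl mulr_ge0 // exprn_ge0.
apply: (IH u den rec c' j.+1) => //; first by clear -jd; lia.
move=> N1 N2 h1 h2; have [N12|N12] := ltnP N2 N1; first by rewrite big_geq.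
have [N2j|N2j] := leqP N2 j; last first.
  have -> : N2 = j.+1 by clear -h2 N2j; lia.
  have hN1 : (N1 < j.+2)%N by clear -h1; lia.
  move/existsPn: nohit' => /(_ (Ordinal hN1)) /=.
  by case/andP: h1 => ->.
rewrite (eq_big_nat _ _ (F2 := c)); first by apply: nohit; clear -h1 h2 N12 N2j; lia.
by move=> l hl; apply: c'c; clear -h1 hl N2j; lia.
Qed.

(** The unrolling starts from the empty history, of weight 1, represented by a constant sequence in
    the index set. If that set is empty, no such sequence exists, but the recursion then reads
    [u n <= K]. *)
Lemma lag_recursion_bounded (R : realType) (k : nat) (b : nat -> R)
    (J : {pred nat}) (K L G : R) (N0 : nat) :
  0 <= K -> 0 <= L -> 1 <= G -> nonneg_coefs k b -> 0%N \notin J ->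
  block_sum_property (index_set k b) J ->
  exists (M : R) (N : nat), 0 <= M /\
    forall u den, lag_recursion k b J K L G N0 u den ->
    forall n, (N < n)%N -> u n <= M.
Proof.
move=> K0 L0 G1 b0 J0 [eta [_ block]].
have [/hasP[i0 _ hi0]|/hasPn noI] := boolP (has (mem (index_set k b)) (iota 1 k)).
  have [M [M0 hM]] := history_bound N0 eta K0 L0 G1 b0 J0 block.
  exists M, (N0 + k * eta)%N; split=> // u den rec n hn.
  rewrite -[u n]mulr1; apply: (hM u den rec (fun=> i0) 0%N) => //.
  by move=> N1 N2 h1; lia.
exists K, N0; split=> // u den rec n /rec[_ _ _ + _].
rewrite big_nat_cond big1 ?addr0 // => i /andP[hi _].
suff -> : b i = 0 by rewrite mul0r.
have bi0 : 0 <= b i by rewrite b0.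
have /noI : i \in iota 1 k by rewrite mem_iota; lia.
by rewrite !inE; have -> : (1 <= i <= k)%N by [lia|]; rewrite /= -leNgt => ?; lra.
Qed.

(** * Estimates for affine lag expressions *)

Section AffineLags.
Variables (R : realType) (k : nat).
Implicit Types (a : R) (u v : nat -> R) (x y : int -> R).

Definition nonneg_before x (n : nat) : Prop :=
  forall i : nat, (1 <= i <= k)%N -> 0 <= x (n%:Z - i%:Z).

Lemma lag_sum_ge0 u x n : nonneg_coefs k u -> nonneg_before x n ->
  0 <= \sum_(1 <= i < k.+1) u i * x (n%:Z - i%:Z).
Proof.
move=> u0 x0; rewrite big_nat_cond sumr_ge0 // => i /andP[hi _].
by rewrite mulr_ge0 ?u0 ?x0.
Qed.

Lemma affine_lag_ge0 a u v x y n : 0 <= a -> nonneg_coefs k u ->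
  nonneg_coefs k v -> nonneg_before x n -> nonneg_before y n ->
  0 <= affine_lag k a u v x y n.
Proof. by move=> *; rewrite /affine_lag !addr_ge0 ?lag_sum_ge0. Qed.

Lemma term_le_sum (F : nat -> R) s :
  (forall i, (1 <= i <= k)%N -> 0 <= F i) -> (1 <= s <= k)%N ->
  F s <= \sum_(1 <= i < k.+1) F i.
Proof.
move=> F0 hs; rewrite (bigD1_seq s) ?iota_uniq //=; last first.
  by rewrite mem_index_iota.
by rewrite lerDl big_seq_cond sumr_ge0 // => i; rewrite mem_index_iota => /andP[/F0].
Qed.

Lemma affine_lag_bounds a u v x y n s : 0 <= a -> nonneg_coefs k u ->
  nonneg_coefs k v -> nonneg_before x n -> nonneg_before y n ->
  (1 <= s <= k)%N ->
  [/\ a <= affine_lag k a u v x y n,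
      u s * x (n%:Z - s%:Z) <= affine_lag k a u v x y n
    & v s * y (n%:Z - s%:Z) <= affine_lag k a u v x y n].
Proof.
move=> a0 u0 v0 x0 y0 hs; rewrite /affine_lag.
have Sx := lag_sum_ge0 u0 x0; have Sy := lag_sum_ge0 v0 y0.
have tx : u s * x (n%:Z - s%:Z) <= \sum_(1 <= i < k.+1) u i * x (n%:Z - i%:Z).
  by apply: term_le_sum => // i hi; rewrite mulr_ge0 ?u0 ?x0.
have ty : v s * y (n%:Z - s%:Z) <= \sum_(1 <= i < k.+1) v i * y (n%:Z - i%:Z).
  by apply: term_le_sum => // i hi; rewrite mulr_ge0 ?v0 ?y0.
by split; lra.
Qed.

(** The sum of all ratios dominates each of them. Where [v i = 0], the inclusion forces [u i = 0],
    and division by zero gives 0; the added 1 makes [K] positive. *)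
Lemma coefs_dominated u v : nonneg_coefs k u -> nonneg_coefs k v ->
  {subset index_set k u <= index_set k v} ->
  exists K : R, 0 < K /\ forall i, (1 <= i <= k)%N -> u i <= K * v i.
Proof.
move=> u0 v0 uv; exists (1 + \sum_(1 <= i < k.+1) u i / v i).
have F0 i : (1 <= i <= k)%N -> 0 <= u i / v i.
  by move=> hi; rewrite divr_ge0 ?u0 ?v0.
have S0 : 0 <= \sum_(1 <= i < k.+1) u i / v i.
  by rewrite big_nat_cond sumr_ge0 // => i /andP[/F0].
split=> [|i hi]; first by lra.
have [ui|ui] := ltP 0 (u i); last first.
  by apply: (le_trans ui); rewrite mulr_ge0 ?v0 // addr_ge0.
have /andP[_ vi] : i \in index_set k v by apply: uv; rewrite inE hi.
rewrite -ler_pdivrMr //; apply: (le_trans (term_le_sum F0 hi)).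
by rewrite lerDr.
Qed.

Lemma affine_lag_dominated a a' u u' v v' :
  0 <= a -> 0 <= a' -> (0 < a -> 0 < a') ->
  nonneg_coefs k u -> nonneg_coefs k u' -> nonneg_coefs k v ->
  nonneg_coefs k v' -> {subset index_set k u <= index_set k u'} ->
  {subset index_set k v <= index_set k v'} ->
  exists K : R, 0 < K /\ forall x y n, nonneg_before x n -> nonneg_before y n ->
    affine_lag k a u v x y n <= K * affine_lag k a' u' v' x y n.
Proof.
move=> a0 a'0 aa' u0 u'0 v0 v'0 uu' vv'.
have [K1 [K10 hK1]] := coefs_dominated u0 u'0 uu'.
have [K2 [K20 hK2]] := coefs_dominated v0 v'0 vv'.
have r0 : 0 <= a / a' by rewrite divr_ge0.
exists (a / a' + K1 + K2); split=> [|x y n x0 y0]; first by lra.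
rewrite /affine_lag !mulrDr !mulr_sumr; apply: lerD; first apply: lerD.
- have [ap|ap] := ltP 0 a; last first.
    by apply: (le_trans ap); rewrite mulr_ge0 //; lra.
  by rewrite -addrA mulrDl divfK ?gt_eqF ?aa' // lerDl mulr_ge0 // addr_ge0 // ltW.
- rewrite big_nat_cond [leRHS]big_nat_cond ler_sum // => i /andP[hi _].
  rewrite mulrA ler_wpM2r ?x0 //; apply: (le_trans (hK1 i hi)).
  by rewrite ler_wpM2r ?u'0 //; lra.
- rewrite big_nat_cond [leRHS]big_nat_cond ler_sum // => i /andP[hi _].
  rewrite mulrA ler_wpM2r ?y0 //; apply: (le_trans (hK2 i hi)).
  by rewrite ler_wpM2r ?v'0 //; lra.
Qed.

(** Summing all inverses gives a constant independent of [s]; vanishing coefficients contribute 0,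
    the inverse of 0 being 0. *)
Lemma le_sum_inv u s t d : nonneg_coefs k u -> s \in index_set k u ->
  0 <= d -> u s * t <= d -> t <= (\sum_(1 <= i < k.+1) (u i)^-1) * d.
Proof.
move=> u0 /andP[hs us] d0 hd.
apply: (@le_trans _ _ ((u s)^-1 * d)).
  by rewrite mulrC ler_pdivlMr // mulrC.
rewrite ler_wpM2r //; apply: (@term_le_sum (fun i => (u i)^-1)) => // i hi.
by rewrite invr_ge0 u0.
Qed.

Lemma sum_inv_ge0 u : nonneg_coefs k u -> 0 <= \sum_(1 <= i < k.+1) (u i)^-1.
Proof.
move=> u0; rewrite big_nat_cond sumr_ge0 // => i /andP[hi _].
by rewrite invr_ge0 u0.
Qed.

Lemma solution_nonneg alpha beta gamma A B C p delta epsilon q D E x y :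
  0 <= alpha -> nonneg_coefs k beta -> nonneg_coefs k gamma ->
  0 <= p -> nonneg_coefs k delta -> nonneg_coefs k epsilon ->
  solution k alpha beta gamma A B C p delta epsilon q D E x y ->
  forall m : int, 1 - k%:Z <= m -> 0 <= x m /\ 0 <= y m.
Proof.
move=> alpha0 beta0 gamma0 p0 delta0 epsilon0 [init rec].
(* Induction on an upper bound for the index makes the initial conditions the case [n = 0]. *)
suff H (n : nat) (m : int) : 1 - k%:Z <= m <= n%:Z -> 0 <= x m /\ 0 <= y m.
  by move=> m hm; apply: (H `|m|%N); lia.
elim: n m => [|n IH] m hm; first exact: init.
have [mn|mn] := lerP m n%:Z; first by apply: IH; lia.
have -> : m = n.+1%:Z by lia.
have x0 : nonneg_before x n.+1 by move=> i hi; apply: (IH _ _).1; lia.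
have y0 : nonneg_before y n.+1 by move=> i hi; apply: (IH _ _).2; lia.
have [//|d1 d2 -> ->] := rec n.+1.
by split; apply: divr_ge0; rewrite ?(ltW d1) ?(ltW d2) ?affine_lag_ge0.
Qed.

End AffineLags.

Theorem theorem18 (R : realType) (k : nat)
    (alpha : R) (beta gamma : nat -> R) (A : R) (B C : nat -> R)
    (p : R) (delta epsilon : nat -> R) (q : R) (D E : nat -> R)
    (hk : (1 <= k)%N)
    (halpha : 0 <= alpha) (hA0 : 0 <= A) (hp : 0 <= p) (hq0 : 0 <= q)
    (hbeta : nonneg_coefs k beta) (hgamma : nonneg_coefs k gamma)
    (hB : nonneg_coefs k B) (hC : nonneg_coefs k C)
    (hdelta : nonneg_coefs k delta) (hepsilon : nonneg_coefs k epsilon)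
    (hD : nonneg_coefs k D) (hE : nonneg_coefs k E)
    (hyx : exists M1 M2 : R, [/\ 0 < M1, 0 <= M2 &
      forall x y : int -> R,
        solution k alpha beta gamma A B C p delta epsilon q D E x y ->
        forall n : nat, (1 <= n)%N -> y n%:Z <= M1 * x n%:Z + M2])
    (hA : A = 0) (hq : 0 < q)
    (hcases :
      [/\ {subset index_set k B <= index_set k beta},
          {subset index_set k C <= index_set k gamma}
        & exists j, j \in index_set k B]
      \/
      [/\ 0 < p,
          {subset index_set k D <= index_set k delta},
          {subset index_set k E <= index_set k epsilon}
        & exists j, j \in index_set k C])
    (hdeltaD : {subset index_set k delta <= index_set k D})
    (heta1 : block_sum_property (index_set k epsilon)
               [predU index_set k D & index_set k E])
    (heta2 : block_sum_property (index_set k beta) (index_set k B)) :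
  exists (M : R) (N : nat), [/\ 0 < M, (1 <= N)%N &
    forall x y : int -> R,
      solution k alpha beta gamma A B C p delta epsilon q D E x y ->
      forall n : nat, (N < n)%N -> x n%:Z <= M /\ y n%:Z <= M].
Proof.
subst A.
have sol_bounds x y n :
    solution k alpha beta gamma 0 B C p delta epsilon q D E x y -> (1 <= n)%N ->
    [/\ nonneg_before k x n, nonneg_before k y n, 0 <= x n%:Z & 0 <= y n%:Z].
  move=> sol hn.
  have H := solution_nonneg halpha hbeta hgamma hp hdelta hepsilon sol.
  by split=> [i hi|i hi||]; apply H; lia.
have [M1 [M2 [M10 M20 {}hyx]]] := hyx.
have lagZ (n i : nat) : (i <= n)%N -> (n - i)%N%:Z = n%:Z - i%:Z by lia.
have inI (u : nat -> R) s : s \in index_set k u -> (1 <= s <= k)%N by case/andP.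

(* Eventual bound for [y] *)
have none (v : nat -> R) : {subset index_set k (fun=> 0 : R) <= index_set k v}.
  by move=> i; rewrite !inE ltxx andbF.
have zero0 : nonneg_coefs k (fun=> 0 : R) by [].
(* Zero in place of [epsilon] isolates [p] and the [delta] terms, which the denominator
   dominates. *)
have [Ky [Ky0 hKy]] := affine_lag_dominated hp hq0 (fun=> hq) hdelta hD zero0 hE
  hdeltaD (none E).
(* The first two summands serve [s] in [index_set k D], through [hyx] and the bound of the
   denominator below by [q]; the third serves [index_set k E]. *)
pose Ly := M1 * (\sum_(1 <= i < k.+1) (D i)^-1) + M2 / q
           + \sum_(1 <= i < k.+1) (E i)^-1.
have SD := sum_inv_ge0 hD; have SE := sum_inv_ge0 hE; have SB := sum_inv_ge0 hB.
have T1 : 0 <= M1 * (\sum_(1 <= i < k.+1) (D i)^-1) by rewrite mulr_ge0 // ltW.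
have T2 : 0 <= M2 / q by rewrite divr_ge0.
have Ly0 : 0 <= Ly by rewrite /Ly !addr_ge0.
have qi0 : 0 < q^-1 by rewrite invr_gt0.
have [My [Ny [My0 hMy]]] : exists (My : R) (Ny : nat), 0 <= My /\
    forall x y, solution k alpha beta gamma 0 B C p delta epsilon q D E x y ->
    forall n, (Ny < n)%N -> y n%:Z <= My.
  (* Starting after [k] puts every lagged index at 1 or later, where [hyx] is available. The 1 in
     [1 + q^-1] secures [1 <= G]. *)
  have [||||||M [N [M0 hM]]] := @lag_recursion_bounded R k epsilon
    [predU index_set k D & index_set k E] Ky Ly (1 + q^-1) k => //; first lra.
  - by rewrite lerDl ltW.
  exists M, N; split=> // x y sol n hn.
  apply: (hM (fun m => y m%:Z) (affine_lag k q D E x y)) => // {n hn} n kn.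
  have n1 : (1 <= n)%N by clear -kn; lia.
  have [x0 y0 _ yn0] := sol_bounds _ _ _ sol n1.
  have [_ d0 _ yE] := sol.2 n n1.
  have dq s (hs : (1 <= s <= k)%N) := affine_lag_bounds hq0 hD hE x0 y0 hs.
  have qd : q <= affine_lag k q D E x y n by have [] := dq 1%N; rewrite ?hk.
  split=> //.
  - apply: (@le_trans _ _ q^-1); last by lra.
    by rewrite lef_pV2 ?posrE.
  - rewrite yE /affine_lag -/(affine_lag k q D E x y n) mulrDl lerD //.
      rewrite ler_pdivrMr //; apply: le_trans (hKy x y n x0 y0).
      rewrite /affine_lag lerDl big_nat_cond sumr_ge0 // => i _.
      by rewrite mul0r.
    rewrite mulr_suml big_nat_cond [leRHS]big_nat_cond ler_sum // => i /andP[hi _].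
    by rewrite -mulrA lagZ //; clear -hi kn; lia.
  - move=> s sJ.
    have hs : (1 <= s <= k)%N by case/orP: sJ => /inI.
    have [_ dx dy] := dq s hs.
    have ns : (s < n)%N by clear -hs kn; lia.
    have d0' := ltW d0.
    rewrite lagZ ?(ltnW ns) //; case/orP: sJ => sI.
      have Dx := le_sum_inv hD sI d0' dx.
      have : y (n%:Z - s%:Z) <= M1 * x (n%:Z - s%:Z) + M2.
        by rewrite -lagZ ?(ltnW ns) //; apply: hyx sol _ _; rewrite subn_gt0.
      move/le_trans; apply; rewrite /Ly !mulrDl.
      have := mulr_ge0 SE d0'; have := ler_wpM2l (ltW M10) Dx; rewrite mulrA.
      suff : M2 <= M2 / q * affine_lag k q D E x y n by lra.
      by rewrite mulrAC ler_pdivlMr // ler_wpM2l.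
    apply: (le_trans (le_sum_inv hE sI d0' dy)).
    by rewrite ler_wpM2r // /Ly lerDr addr_ge0.

(* Lower bound for the denominator of [x] *)
have [a [a0 ha]] : exists a : R, 0 < a /\ forall x y,
    solution k alpha beta gamma 0 B C p delta epsilon q D E x y ->
    forall n, (k < n)%N -> a <= affine_lag k 0 B C x y n.
  case: hcases => [[Bb Cg [j jI]]|[p0 Dd Ee [j jI]]]; have jk := inI _ _ jI;
    have /andP[_ j0] := jI.
    have alpha' : 0 < (0 : R) -> 0 < alpha by rewrite ltxx.
    have [K [K0 hK]] := affine_lag_dominated (lexx 0) halpha alpha'
      hB hbeta hC hgamma Bb Cg.
    (* From index 1 on, the denominator is at most [K] times the numerator, so [x] is at least
       [K^-1]; [k < n] makes [n - j] such an index. *)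
    exists (B j * K^-1); split; first by rewrite mulr_gt0 ?invr_gt0.
    move=> x y sol n kn; have n1 : (1 <= n)%N by clear -kn; lia.
    have [x0 y0 _ _] := sol_bounds _ _ _ sol n1.
    have [_ dx _] := affine_lag_bounds (lexx 0) hB hC x0 y0 jk.
    apply: le_trans dx; rewrite ler_wpM2l ?(ltW j0) // -lagZ; last by clear -jk kn; lia.
    have nj1 : (1 <= n - j)%N by clear -jk kn; lia.
    have [x0' y0' _ _] := sol_bounds _ _ _ sol nj1.
    have [d0 _ -> _] := sol.2 _ nj1.
    by rewrite ler_pdivlMr // ler_pdivrMl //; apply: hK.
  have [K [K0 hK]] := affine_lag_dominated hq0 hp (fun=> p0)
    hD hdelta hE hepsilon Dd Ee.
  (* Here [y] stays above [K^-1], and [C j] carries this into the denominator of [x]. *)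
  exists (C j * K^-1); split; first by rewrite mulr_gt0 ?invr_gt0.
  move=> x y sol n kn; have n1 : (1 <= n)%N by clear -kn; lia.
  have [x0 y0 _ _] := sol_bounds _ _ _ sol n1.
  have [_ _ dy] := affine_lag_bounds (lexx 0) hB hC x0 y0 jk.
  apply: le_trans dy; rewrite ler_wpM2l ?(ltW j0) // -lagZ; last by clear -jk kn; lia.
  have nj1 : (1 <= n - j)%N by clear -jk kn; lia.
  have [x0' y0' _ _] := sol_bounds _ _ _ sol nj1.
  have [_ d0 _ ->] := sol.2 _ nj1.
  by rewrite ler_pdivlMr // ler_pdivrMl //; apply: hK.

(* Eventual bound for [x] *)
have ai0 : 0 < a^-1 by rewrite invr_gt0.
pose S := alpha + \sum_(1 <= i < k.+1) gamma i * My.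
have S0 : 0 <= S.
  rewrite addr_ge0 // big_nat_cond sumr_ge0 // => i /andP[hi _].
  by rewrite mulr_ge0 ?hgamma.
have [Mx [Nx [Mx0 hMx]]] : exists (Mx : R) (Nx : nat), 0 <= Mx /\
    forall x y, solution k alpha beta gamma 0 B C p delta epsilon q D E x y ->
    forall n, (Nx < n)%N -> x n%:Z <= Mx.
  (* After [k + Ny] all lagged indices exceed [Ny], so [S] bounds the [alpha] and [gamma] part of
     the numerator. *)
  have [||||||M [N [M0 hM]]] := @lag_recursion_bounded R k beta
    (index_set k B) (S / a) (\sum_(1 <= i < k.+1) (B i)^-1) (1 + a^-1)
    (k + Ny)%N => //.
  - by rewrite divr_ge0 // ltW.
  - by rewrite lerDl ltW.
  exists M, N; split=> // x y sol n hn.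
  apply: (hM (fun m => x m%:Z) (affine_lag k 0 B C x y)) => // {n hn} n kn.
  have n1 : (1 <= n)%N by clear -kn; lia.
  have nk : (k < n)%N by clear -kn; lia.
  have [x0 y0 xn0 _] := sol_bounds _ _ _ sol n1.
  have [d0 _ xE _] := sol.2 n n1.
  have ad := ha _ _ sol n nk.
  have da : (affine_lag k 0 B C x y n)^-1 <= a^-1 by rewrite lef_pV2 ?posrE.
  split=> //.
  - by lra.
  - rewrite xE /affine_lag -/(affine_lag k 0 B C x y n) addrAC mulrDl lerD //.
      apply: ler_pM => //; first by rewrite addr_ge0 // lag_sum_ge0.
        by rewrite invr_ge0 ltW.
      rewrite lerD2l big_nat_cond [leRHS]big_nat_cond ler_sum // => i /andP[hi _].
      rewrite ler_wpM2l ?hgamma // -lagZ; last by clear -hi kn; lia.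
      by apply: hMy sol _ _; clear -hi kn; lia.
    rewrite mulr_suml big_nat_cond [leRHS]big_nat_cond ler_sum // => i /andP[hi _].
    by rewrite -mulrA lagZ //; clear -hi kn; lia.
  - move=> s sI; have hs := inI _ _ sI.
    have [_ dx _] := affine_lag_bounds (lexx 0) hB hC x0 y0 hs.
    by rewrite lagZ; [apply: le_sum_inv sI (ltW d0) dx|clear -hs kn; lia].
exists (Mx + My + 1), (Nx + Ny + 1)%N; split; [lra|by rewrite addn1|] => x y sol n hn.
have xb : x n%:Z <= Mx by apply: hMx sol _ _; clear -hn; lia.
have yb : y n%:Z <= My by apply: hMy sol _ _; clear -hn; lia.
by split; lra.
Qed.
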